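(* Let $$\mathcal{G}=\begin{bmatrix}\partial_x&0&0&0\\0&\mathrm{Id}&0&0\\0&0&\partial_x&0\\0&0&0&\mathrm{Id}\\\partial_x&0&-\mathrm{Id}&0\end{bmatrix}:(H^1\cap L_0^2)\times L^2\times H^1\times L^2\to(L^2)^5$$ be the transformation from the implicit to the explicit Timoshenko representation, let $$\mathcal{F}(z)=\Big(x\mapsto\int_a^xz_1\,dy-\frac1{b-a}\int_a^b\int_a^yz_1(s)\,ds\,dy,\ \ z_2,\ \ z_1-z_5,\ \ z_4\Big),\qquad z\in(L^2)^5,$$ be the transformation in the opposite direction, and let $\Pi^E:=\mathrm{Diag}(\mathrm{Id},\mathrm{Id},\mathrm{Id},0,0)$ be the operator which, premultiplying the left-hand side of the explicit Timoshenko system, yields the explicit (descriptor) Euler--Bernoulli system. Then, on $(H^1\cap L_0^2)\times L^2\times H^1\times L^2$, $$\mathcal{F}\,\Pi^E\,\mathcal{G}=\Pi^I:=\begin{bmatrix}\mathrm{Id}&0&0&0\\0&\mathrm{Id}&0&0\\\partial_x&0&0&0\\0&0&0&0\end{bmatrix},$$ where $\Pi^I$ is the operator which, premultiplying the left-hand side of the implicit Timoshenko system, yields the implicit (descriptor) Euler--Bernoulli system. In other words, passing from the implicit Timoshenko to the implicit Euler--Bernoulli representation directly by $\Pi^I$ is the same as passing through the explicit representations via $\mathcal{G}$, then $\Pi^E$, then $\mathcal{F}$.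
   Context: $\Omega=[a,b]$ is a bounded interval, $L^2=L^2(\Omega)$, $H^1=H^1(\Omega)$, $L^2_0$ is the space of square-integrable functions with zero mean. Explicit Timoshenko system: $\partial_tz^E=\mathcal{J}^Ee^E$ with state $z^E=(\varepsilon_w,p_w,\varepsilon_\phi,p_\phi,\varepsilon_{w,\phi})$, effort $e^E=(\sigma_w,v,\sigma_\phi,\omega,N)$ and $$\mathcal{J}^E=\begin{bmatrix}0&\partial_x&0&0&0\\\partial_x&0&0&0&\partial_x\\0&0&0&\partial_x&0\\0&0&\partial_x&0&\mathrm{Id}\\0&\partial_x&0&-\mathrm{Id}&0\end{bmatrix}.$$ Explicit Euler--Bernoulli descriptor system: $\Pi^E\partial_tz^E=\mathcal{J}^Ee^E$. Implicit Timoshenko system: $\partial_tz^I=\mathcal{J}^Ie^I$ with state $z^I=(w,p_w,\phi,p_\phi)$, effort $e^I=(\delta_w\mathcal{H}^I,\delta_{p_w}\mathcal{H}^I,\delta_\phi\mathcal{H}^I,\delta_{p_\phi}\mathcal{H}^I)$ and $$\mathcal{J}^I=\begin{bmatrix}0&\mathrm{Id}&0&0\\-\mathrm{Id}&0&0&0\\0&0&0&\mathrm{Id}\\0&0&-\mathrm{Id}&0\end{bmatrix}.$$ Implicit Euler--Bernoulli descriptor system: $\Pi^I\partial_tz^I=\mathcal{J}^Ie^I$. Here $w$ is the transverse displacement, $\phi$ the shear angle, $p_w,p_\phi$ the linear and angular momenta, $\varepsilon_w=\partial_xw$, $\varepsilon_\phi=\partial_x\phi$, $\varepsilon_{w,\phi}=\partial_xw-\phi$.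 *)

(* Defs.v *)
From HB Require Import structures.
From mathcomp Require Import all_boot all_order all_algebra.
From mathcomp Require Import all_classical all_reals all_analysis.
From mathcomp Require Import measurable_realfun.

Set Implicit Arguments.
Unset Strict Implicit.
Unset Printing Implicit Defensive.
Import Order.TTheory GRing.Theory Num.Theory.
Import numFieldNormedType.Exports.
Local Open Scope classical_set_scope.
Local Open Scope ring_scope.
Local Open Scope quotient_scope.

Lemma measurable_ccitv {R : realType} (a b : R) :
  measurable (`[a, b]%classic : set (measurableTypeR R)).
Proof. exact: measurable_itv. Qed.

Lemma lebesgue_ccitv_fin {R : realType} (a b : R) :
  (lebesgue_measure (`[a, b]%classic : set (measurableTypeR R)) < +oo)%E.
Proof. by rewrite lebesgue_measure_itv; case: ifP => //= _; rewrite ltry. Qed.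

Section L2_space.
Context {R : realType}.
Variables a b : R.

(* Lebesgue measure on [a, b], carried by the whole line: functions on [a, b]
   are represented by functions on R, whose values outside [a, b] are
   irrelevant up to equality almost everywhere for this measure. *)
Definition leb : {finite_measure set (measurableTypeR R) -> \bar R} :=
  mfrestr (measurable_ccitv a b) (lebesgue_ccitv_fin a b).

(* Elements are classes of functions modulo equality almost everywhere, so
   that equality in [L2] is Leibniz equality; an element coerces to a
   representative. *)
Definition L2 : Type := LspaceType2 leb.
HB.instance Definition _ := gen_eqMixin L2.
HB.instance Definition _ := gen_choiceMixin L2.

Definition L2_fun (u : L2) : R -> R :=
  aqEqMfun_to_fun (u : {mfun_ leb, _ >-> measurableTypeR R}).

End L2_space.
Coercion L2_fun : L2 >-> Funclass.

Section L2_class.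
Context {R : realType} {a b : R}.
Local Notation mu := (leb a b).
Implicit Types (u v w : L2 a b) (f g : R -> R).

Lemma L2_Lfun u : (u : R -> R) \in Lfun mu 2%:E.
Proof.
rewrite inE; apply/andP; split; rewrite inE /=; last exact: (@Lebesgue_finite _ _ _ _ _ _ u).
exact: (@measurable_funPT _ _ _ _ (repr (u : {mfun_ mu, _ >-> measurableTypeR R}))).
Qed.

Lemma L2_eq u v : (u : R -> R) = v %[ae mu] -> u = v.
Proof.
case: u v => [u [[uP]]] [v [[vP]]]; rewrite /L2_fun /= => uv.
have : u = v.
  by rewrite -[u]reprK -[v]reprK; apply/eqP; rewrite eqmodE; apply/asboolP.
by move=> E; move: uP; rewrite E => uP; rewrite (Prop_irrelevance uP vP).
Qed.

#[export] Instance leb_ae_filter : Filter (nbhs (almost_everywhere mu)).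
Proof. exact: ae_filter_ringOfSetsType. Qed.

Lemma finite_norm_ae f g : measurable_fun setT f -> measurable_fun setT g ->
  f = g %[ae mu] -> finite_norm mu 2%:E f -> finite_norm mu 2%:E g.
Proof.
move=> mf mg fg; rewrite /finite_norm unlock /=.
have meas (h : R -> R) : measurable_fun setT h ->
    measurable_fun setT (fun x : R => (`|h x| `^ 2)%:E).
  move=> mh; apply/measurable_EFinP.
  apply: (@measurableT_comp _ _ _ _ _ _ (@powR R ^~ 2)) => //.
  exact: measurableT_comp.
rewrite (@ae_eq_integral _ _ _ mu setT (fun x : R => (`|g x| `^ 2)%:E)) //;
  try exact: meas.
by apply: (filterS _ fg) => x /= /(_ Logic.I) ->.
Qed.

Section class_of.
Variables (f : R -> R) (f2 : f \in Lfun mu 2%:E).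

Let fm : f \in @mfun _ _ (measurableTypeR R) (measurableTypeR R).
Proof. exact: sub_Lfun_mfun f2. Qed.

Let f' := @mfun_Sub _ _ (measurableTypeR R) (measurableTypeR R) f fm.

Let cls : {mfun_ mu, _ >-> measurableTypeR R} :=
  \pi_({mfun_ mu, _ >-> measurableTypeR R}) f'.

Let clsE : f = (cls : R -> R) %[ae mu].
Proof.
have /eqmodP/asboolP : f' = repr cls %[mod {mfun_ mu, _ >-> measurableTypeR R}].
  by rewrite reprK.
exact.
Qed.

Let cls_fin : finite_norm mu 2%:E cls.
Proof.
apply: (finite_norm_ae _ _ clsE).
- exact/set_mem/fm.
- exact: (@measurable_funPT _ _ _ _ (repr cls)).
- exact/set_mem/(sub_Lfun_finLfun f2).
Qed.

Let cls_mixin := @isFinLebesgue.Build _ _ _ mu 2%:E (lee1n 2) cls cls_fin.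

Definition L2_class : L2 a b :=
  @LebesgueSpace.Pack _ _ _ mu 2%:E (lee1n 2) cls
    (@LebesgueSpace.Class _ _ _ _ _ _ _ cls_mixin).

Lemma L2_classE : (L2_class : R -> R) = f %[ae mu].
Proof. exact/ae_eq_sym/clsE. Qed.

End class_of.

Let p2 : (1 <= 2%:E :> \bar R)%E := lee1n 2.

Let Lfun0 : (fun=> 0 : R) \in Lfun mu 2%:E.
Proof. exact: (Lfun_submod_closed mu p2).1. Qed.

Let LfunD u v : (fun x => u x + v x) \in Lfun mu 2%:E.
Proof. exact: (Lfun_addr_closed mu p2).2 (L2_Lfun u) (L2_Lfun v). Qed.

Let LfunN u : (fun x => - u x) \in Lfun mu 2%:E.
Proof. exact: Lfun_oppr_closed (L2_Lfun u). Qed.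

Let zero := L2_class Lfun0.
Let add u v := L2_class (LfunD u v).
Let opp u := L2_class (LfunN u).

Let addE u v : (add u v : R -> R) = (fun x => u x + v x) %[ae mu].
Proof. exact: L2_classE. Qed.

Let oppE u : (opp u : R -> R) = (fun x => - u x) %[ae mu].
Proof. exact: L2_classE. Qed.

Let zeroE : (zero : R -> R) = (fun=> 0) %[ae mu].
Proof. exact: L2_classE. Qed.

Let addA : associative add.
Proof.
move=> u v w; apply: L2_eq.
move: (addE u (add v w)) (addE v w) (addE (add u v) w) (addE u v) => E1 E2 E3 E4.
apply: (filterS _ (filterI (filterI E1 E2) (filterI E3 E4))).
move=> x /= [[/(_ Logic.I) -> /(_ Logic.I) ->] [/(_ Logic.I) -> /(_ Logic.I) ->]].
by rewrite addrA.
Qed.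

Let addC : commutative add.
Proof.
move=> u v; apply: L2_eq; apply: (filterS _ (filterI (addE u v) (addE v u))).
by move=> x /= [/(_ Logic.I) -> /(_ Logic.I) ->]; rewrite addrC.
Qed.

Let add0 : left_id zero add.
Proof.
move=> u; apply: L2_eq; apply: (filterS _ (filterI (addE zero u) zeroE)).
by move=> x /= [/(_ Logic.I) -> /(_ Logic.I) ->]; rewrite add0r.
Qed.

Let addN : left_inverse zero opp add.
Proof.
move=> u; apply: L2_eq; apply: (filterS _ (filterI (addE (opp u) u) (filterI (oppE u) zeroE))).
by move=> x /= [/(_ Logic.I) -> [/(_ Logic.I) -> /(_ Logic.I) ->]]; rewrite addNr.
Qed.

HB.instance Definition _ := GRing.isZmodule.Build (L2 a b) addA addC add0 addN.

Lemma L2_0E : ((0 : L2 a b) : R -> R) = (fun=> 0) %[ae mu].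
Proof. exact: zeroE. Qed.

Lemma L2_BE u v : ((u - v : L2 a b) : R -> R) = (fun x => u x - v x) %[ae mu].
Proof.
apply: (filterS _ (filterI (addE u (opp v)) (oppE v))).
by move=> x /= [/(_ Logic.I) -> /(_ Logic.I) ->].
Qed.

End L2_class.

Section Sobolev.
Context {R : realType} {a b : R}.
Local Notation mu := (leb a b).
Implicit Types u v : L2 a b.

(* C_c^oo(]a, b[), with functions extended by zero to the whole line; the
   closure is compact since ]a, b[ is bounded. *)
Definition test_function (phi : R -> R) : Prop :=
  (forall n x, derivable (derive1n n phi) x 1) /\
  closure [set x | phi x != 0] `<=` `]a, b[.

Definition weak_derivative u v : Prop := forall phi : R -> R,
  test_function phi ->
  \int[mu]_x (u x * derive1 phi x) = - \int[mu]_x (v x * phi x).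

Definition H1 : set (L2 a b) := [set u | exists v, weak_derivative u v].

Definition L20 : set (L2 a b) := [set u | \int[mu]_x u x = 0].

(* The weak derivative of [u] if [u] is in [H1]; a junk value, zero, otherwise. *)
Definition Dx u : L2 a b := xget 0 (weak_derivative u).

End Sobolev.
Arguments test_function {R} a b phi.

Section primitive.
Context {R : realType} {a b : R}.
Local Notation mu := (leb a b).
Implicit Type u : L2 a b.

Lemma L2_integrable u (A : set (measurableTypeR R)) : measurable A ->
  mu.-integrable A (EFin \o (u : R -> R)).
Proof.
move=> mA; apply: (@integrableS _ _ _ _ setT) => //.
apply/Lfun1_integrable; apply: Lfun_subset12; last exact: L2_Lfun.
by rewrite fin_num_measure.
Qed.

Lemma bounded_Lfun (f : R -> R) (M : R) : measurable_fun setT f ->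
  (forall x, `|f x| <= M) -> f \in Lfun mu 2%:E.
Proof.
move=> mf fM; rewrite inE; apply/andP; split; rewrite inE //=.
rewrite /finite_norm unlock /Lnorm poweR_lty//.
have meas (h : R -> R) : measurable_fun setT h ->
    measurable_fun setT (fun x : R => (`|h x| `^ 2)%:E).
  move=> mh; apply/measurable_EFinP.
  apply: (@measurableT_comp _ _ _ _ _ _ (@powR R ^~ 2)) => //.
  exact: measurableT_comp.
apply: (@le_lt_trans _ _ (\int[mu]_x (M `^ 2)%:E)%E).
  apply: ge0_le_integral => //.
  - by move=> x _; rewrite lee_fin powR_ge0.
  - exact: meas.
  - by move=> x _; rewrite lee_fin ge0_ler_powR ?nnegrE// (le_trans _ (fM x)).
by rewrite integral_cst// lte_mul_pinfty// ?lee_fin ?powR_ge0// fin_num_fun_lty.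
Qed.

Let integral_nd (h : R -> R) : (forall x, 0 <= h x) ->
  mu.-integrable setT (EFin \o h) ->
  nondecreasing_fun (fun x : R => \int[mu]_(y in `[a, x]) h y).
Proof.
move=> h0 ih x y xy.
have sub z : mu.-integrable `[a, z] (EFin \o h) by apply: integrableS ih.
rewrite /Rintegral fine_le ?integrable_fin_num//.
apply: ge0_subset_integral => //.
- by move/integrableP: (sub y) => [].
- by move=> t _; rewrite lee_fin.
- by apply: subset_itvl; rewrite bnd_simp.
Qed.

(* The integrals are over [a, x] `&` [a, b], since [mu] lives on [a, b]: for x
   in [a, b] this is the integral from a to x, for other x it is irrelevant. *)
Definition primitive_fun u (x : R) : R :=
  \int[mu]_(y in `[a, x]) u y
  - (b - a)^-1 * \int[mu]_(y in `[a, b]) \int[mu]_(s in `[a, y]) u s.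

Lemma primitive_Lfun u : primitive_fun u \in Lfun mu 2%:E.
Proof.
have iu := L2_integrable u measurableT.
have iabs : mu.-integrable setT (EFin \o (fun y => `|u y|)).
  exact: integrable_abse iu.
have isum : mu.-integrable setT (EFin \o (fun y => `|u y| + u y)).
  by have := integrableD measurableT iabs iu.
pose P (x : R) := \int[mu]_(y in `[a, x]) u y.
have PE : P = (fun x : R => \int[mu]_(y in `[a, x]) (`|u y| + u y)
                    - \int[mu]_(y in `[a, x]) `|u y|).
  apply/funext => x; rewrite -RintegralB//; last 2 first.
  - exact: integrableS isum.
  - exact: integrableS iabs.
  by apply: eq_Rintegral => y _; rewrite addrAC subrr add0r.
have Pmeas : measurable_fun setT P.
  rewrite PE; apply: measurable_funB; apply: nondecreasing_measurable => //.
  - apply: integral_nd isum => x.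
    by rewrite -lerBlDr sub0r -normrN ler_norm.
  - exact: integral_nd iabs.
have Pbnd x : `|P x| <= \int[mu]_y `|u y|.
  apply: le_trans (le_normr_Rintegral _ _) _ => //; first exact: L2_integrable.
  rewrite /Rintegral fine_le ?integrable_fin_num//.
    exact: integrableS iabs.
  apply: ge0_subset_integral => //.
  by move/integrableP: iabs => [].
have := Lfun_addr_closed mu (lee1n 2) => -[_ /(_ P)]; apply.
  exact: bounded_Lfun Pmeas Pbnd.
exact: Lfun_cst.
Qed.

Definition primitive u : L2 a b := L2_class (primitive_Lfun u).

End primitive.

Section operators.
Context {R : realType} {a b : R}.
Local Notation L2 := (L2 a b).

(* (H^1 \cap L^2_0) x L^2 x H^1 x L^2 *)
Definition domI : set (L2 * L2 * L2 * L2) :=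
  [set z | let: (w, pw, phi, pphi) := z in [/\ H1 w, L20 w & H1 phi]].

(* implicit to explicit Timoshenko *)
Definition opG (z : L2 * L2 * L2 * L2) : L2 * L2 * L2 * L2 * L2 :=
  let: (w, pw, phi, pphi) := z in (Dx w, pw, Dx phi, pphi, Dx w - phi).

(* explicit to implicit Timoshenko *)
Definition opF (z : L2 * L2 * L2 * L2 * L2) : L2 * L2 * L2 * L2 :=
  let: (z1, z2, z3, z4, z5) := z in (primitive z1, z2, z1 - z5, z4).

(* Diag(Id, Id, Id, 0, 0) *)
Definition PiE (z : L2 * L2 * L2 * L2 * L2) : L2 * L2 * L2 * L2 * L2 :=
  let: (z1, z2, z3, z4, z5) := z in (z1, z2, z3, 0, 0).

Definition PiI (z : L2 * L2 * L2 * L2) : L2 * L2 * L2 * L2 :=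
  let: (w, pw, phi, pphi) := z in (w, pw, Dx w, 0).

End operators.

(* Main.v *)
Require Import Defs.
From HB Require Import structures.
From mathcomp Require Import all_boot all_order all_algebra.
From mathcomp Require Import all_classical all_reals all_analysis.
From mathcomp Require Import measurable_realfun ring lra.

(* Everything reduces to [primitive (Dx w) = w] for [w] of mean zero in [H1].
   Let [v] be the weak derivative of [w] and let [c < d] be two Lebesgue points
   of [w].  Testing against a smooth plateau that rises from 0 to 1 on [c, c + r]
   and falls back to 0 on [d, d + r], then letting [r] tend to 0, gives
   [w d - w c = \int_c^d v]: the derivative of the plateau is a difference of
   two approximate identities, and the plateau converges boundedly to the
   indicator function of ]c, d].  Hence [w] is almost everywhere the integral of
   [v] from [a] plus a constant, which the zero mean determines. *)

Set Implicit Arguments.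
Unset Strict Implicit.
Unset Printing Implicit Defensive.
Import Order.TTheory GRing.Theory Num.Theory.
Import numFieldNormedType.Exports.
Local Open Scope classical_set_scope.
Local Open Scope ring_scope.

(** * Differentiability to all orders and the construction of a smooth step *)

Section diffn.
Context {R : realType}.
Implicit Types (f g : R -> R) (n m : nat) (x c k : R).

(* Unlike [derive1n], this recursion differentiates first, so that the calculus
   rules below follow by induction on [n]. *)
Fixpoint diffn n f : Prop :=
  if n is m.+1 then (forall x, derivable f x 1) /\ diffn m (derive1 f) else True.

(** The bridge to [test_function], whose smoothness condition is phrased with [derive1n];
    [derive1Sn] moves the innermost derivative to the front. *)
Lemma diffnP f :
  (forall n x, derivable (derive1n n f) x 1) <-> forall n, diffn n f.
Proof.
split=> [fs n | fd n].
  elim: n f fs => //= n IH f fs; split; first exact: (fs 0).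
  by apply: IH => m x; rewrite -derive1Sn; exact: fs.
elim: n f fd => [|n IH] f fd x; first exact: (fd 1).1.
by rewrite derive1Sn; apply: IH => m; exact: (fd m.+1).2.
Qed.

Lemma diffnW n f : diffn n.+1 f -> diffn n f.
Proof.
by elim: n f => //= n IH f [df d2]; split => //; apply: IH.
Qed.

(** Each calculus rule below exhibits a formula for the derivative and passes it here, where the
    induction hypothesis settles the remaining orders. *)
Lemma diffnS n f f' : (forall x, is_derive x 1 f (f' x)) ->
  diffn n f' -> diffn n.+1 f.
Proof.
move=> fd d'; split=> [x|]; first exact: ex_derive.
suff -> : derive1 f = f' by [].
by apply/funext => x; rewrite derive1E derive_val.
Qed.

Lemma diffn_cst n c : diffn n (fun=> c).
Proof.
elim: n c => // n IH c; apply: diffnS (IH 0) => x; exact: is_derive_cst.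
Qed.

Lemma diffn_deriv n f : diffn n.+1 f -> forall x, is_derive x 1 f (derive1 f x).
Proof. by move=> [df _] x; rewrite derive1E; exact: derivableP. Qed.

Lemma diffnD n f g : diffn n f -> diffn n g -> diffn n (fun x => f x + g x).
Proof.
elim: n f g => // n IH f g fn gn.
apply: (@diffnS n _ (fun x => derive1 f x + derive1 g x)); last exact: IH fn.2 gn.2.
by move=> x; exact: is_deriveD (diffn_deriv fn x) (diffn_deriv gn x).
Qed.

Lemma diffnM n f g : diffn n f -> diffn n g -> diffn n (fun x => f x * g x).
Proof.
elim: n f g => // n IH f g fn gn.
apply: (@diffnS n _ (fun x => f x * derive1 g x + g x * derive1 f x)); last first.
  by apply: diffnD; apply: IH => //; [exact: diffnW|exact: gn.2|
    exact: diffnW|exact: fn.2].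
by move=> x; exact: is_deriveM (diffn_deriv fn x) (diffn_deriv gn x).
Qed.

(** The derivative of [1 / f] is [- (1 / f) ^ 2 * f'], which contains [1 / f] again: order [n + 1]
    follows from order [n] for the same [f]. *)
Lemma diffnV n f : (forall x, f x != 0) -> diffn n f ->
  diffn n (fun x => (f x)^-1).
Proof.
move=> f0; elim: n => // n IH fn.
apply: (@diffnS n _ (fun x => (-1) * ((f x)^-1 * (f x)^-1) * derive1 f x)).
  move=> x; have df := diffn_deriv fn x.
  have df1 : derivable f x 1 by exact: ex_derive.
  apply: DeriveDef; first exact: derivableV.
  by rewrite [LHS](deriveV (f0 x) df1) derive_val /GRing.scale/= expr2 invfM mulN1r.
have fi := IH (diffnW fn).
exact: diffnM (diffnM (diffn_cst n (-1)) (diffnM fi fi)) fn.2.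
Qed.

Lemma diffn_affine n f k c : diffn n f -> diffn n (fun x => f (k * x + c)).
Proof.
elim: n f => // n IH f fn.
apply: (@diffnS n _ (fun x => k * derive1 f (k * x + c))); last first.
  exact: diffnM (diffn_cst n k) (IH _ fn.2).
move=> x; have df := diffn_deriv fn (k * x + c).
have da : is_derive x 1 (fun x => k * x + c) k.
  by apply: is_derive_eq; rewrite addr0 ?scaler0 ?addr0 ?add0r /GRing.scale/= ?mulr1.
apply: DeriveDef.
  by apply/derivable1_diffP/differentiable_comp; apply/derivable1_diffP; exact: ex_derive.
rewrite -derive1E derive1_comp; [|exact: ex_derive..].
by rewrite [X in _ * X]derive1E derive_val mulrC.
Qed.

(* The linear span of the family [flat n] is closed under differentiation
   ([is_derive_flat]), which makes [flat 0], the zero extension of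
   [x |-> exp (- 1 / x)], smooth. *)
Definition flat n x : R := if 0 < x then (x^-1) ^+ n * expR (- x^-1) else 0.

Lemma flat_eq0 n x : x <= 0 -> flat n x = 0.
Proof. by move=> x0; rewrite /flat ltNge x0. Qed.

Lemma flat_ge0 n x : 0 <= flat n x.
Proof.
by rewrite /flat; case: ifPn => // x0; rewrite mulr_ge0 ?expR_ge0// exprn_ge0// invr_ge0 ltW.
Qed.

(** With [y = 1 / x], a single term of the exponential series gives [y ^ n / n! <= exp y]. The
    inequality [expR_ge1Dxn] covers positive exponents only, hence the separate case [n = 0]. *)
Lemma flat_le n x : flat n x <= n`!%:R.
Proof.
rewrite /flat; case: ifPn => // x0; rewrite expRN ler_pdivrMr ?expR_gt0//.
have : 0 <= x^-1 by rewrite invr_ge0 ltW.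
move: (x^-1) => y y0; case: n => [|n]; first by rewrite expr0 mul1r -expR0 ler_expR.
have := expR_ge1Dxn n y0 => h.
rewrite -ler_pdivrMl ?ltr0n ?fact_gt0// mulrC; apply: le_trans h.
by rewrite lerDr.
Qed.

Lemma is_derive_flat n x :
  is_derive x 1 (flat n) (flat n.+2 x + - n%:R * flat n.+1 x).
Proof.
have [x0|x0|->] := ltrgtP x 0.
- rewrite !flat_eq0 ?(ltW x0)// mulr0 addr0.
  apply: (@near_eq_is_derive _ _ _ (cst 0) (flat n) x 1 0).
  by near=> y; rewrite flat_eq0//; apply: ltW; near: y; exact: lt_nbhsl.
- rewrite /flat x0.
  apply: (@near_eq_is_derive _ _ _ (fun x => (x^-1) ^+ n * expR (- x^-1)) _ x 1).
  + by near=> y; rewrite /flat ifT//; near: y; exact: lt_nbhsr.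
  have xn0 : x != 0 by rewrite gt_eqF.
  have di : is_derive x 1 (fun x : R => x^-1) (- x ^- 2).
    apply: DeriveDef; first by apply: derivableV.
    by rewrite [LHS](@deriveV _ _ id)// derive_id /GRing.scale/= mulr1.
  have de : is_derive x 1 (fun x : R => expR (- x^-1)) (x ^- 2 * expR (- x^-1)).
    have dn := is_deriveN di.
    apply: (is_derive_eq (@is_derive1_comp R expR _ x _ _ (is_derive_expR _) dn)).
    by rewrite opprK mulrC.
  rewrite (_ : (fun x => _) = (fun x => x^-1) ^+ n * (fun x => expR (- x^-1))); last first.
    by rewrite exprfctE.
  apply: (is_derive_eq (is_deriveM (is_deriveX n di) de)).
  rewrite exprfctE /GRing.scale/= -!exprVn; case: (n) => [|m]; first by rewrite !expr0; ring.
  by rewrite /= !exprS; ring.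
- rewrite !flat_eq0// mulr0 addr0.
  have dq : (h^-1 *: ((flat n \o shift 0) (h *: 1) - flat n 0)) @[h --> 0^'] --> (0 : R).
    (* At 0 the difference quotient is [flat n h / h = h * flat n.+2 h], and [flat n.+2] is bounded,
       so the quotient tends to 0. *)
    have bnd h : `|h^-1 *: ((flat n \o shift 0) (h *: (1:R)) - flat n 0)| <= (n.+2)`!%:R * `|h|.
      rewrite /= addr0 [flat n 0]flat_eq0// subr0 /GRing.scale/= mulr1.
      have -> : h^-1 * flat n h = h * flat n.+2 h.
        rewrite /flat; case: ifPn => [h0|]; last by rewrite !mulr0.
        rewrite !exprS !mulrA; congr (_ * _ * _).
        by rewrite divff ?gt_eqF// mul1r.
      by rewrite normrM mulrC ler_wpM2r// ger0_norm ?flat_le// flat_ge0.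
    apply/norm_cvg0P; apply: (@squeeze_cvgr _ _ _ _ (cst 0) (fun h => (n.+2)`!%:R * `|h|)).
    - by near=> h; rewrite normr_ge0 bnd.
    - exact: cvg_cst.
    - rewrite -[X in _ --> X](mulr0 (n.+2)`!%:R); apply: cvgMr.
      by rewrite -[X in _ --> X](@normr0 _ R); apply: cvg_norm; exact: nbhs_dnbhs.
  by apply: DeriveDef; [apply/cvg_ex; exists 0|apply: cvg_lim].
Unshelve. all: by end_near. Qed.

Lemma diffn_flat m n : diffn m (flat n).
Proof.
elim: m n => // m IH n; apply: diffnS (is_derive_flat n) _.
exact: diffnD (IH _) (diffnM (diffn_cst m _) (IH _)).
Qed.

(* A smooth step from 0 to 1 on [0, 1/2]; ending at 1/2 leaves the derivative
   null at both ends of ]-1, 1[. *)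
Definition step x : R := flat 0 x / (flat 0 x + flat 0 (2^-1 - x)).

(** At least one of [x] and [1/2 - x] is positive, and [flat 0] is positive there. *)
Lemma step_den_gt0 x : 0 < flat 0 x + flat 0 (2^-1 - x).
Proof.
have pos y : 0 < y -> 0 < flat 0 y by move=> y0; rewrite /flat y0 expr0 mul1r expR_gt0.
have [x0|x0] := ltP 0 x; first by rewrite ltr_pwDl ?flat_ge0 ?pos.
by rewrite ltr_wpDl ?flat_ge0// pos//; lra.
Qed.

Lemma diffn_step n : diffn n step.
Proof.
apply: diffnM; first exact: diffn_flat.
apply: diffnV => [x|]; first by rewrite gt_eqF ?step_den_gt0.
apply: diffnD; first exact: diffn_flat.
rewrite (_ : (fun x => _) = (fun x => flat 0 ((-1) * x + 2^-1))).
  by apply: diffn_affine; exact: diffn_flat.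
by apply/funext => x; congr flat; ring.
Qed.

Lemma step_ge0 x : 0 <= step x.
Proof. by rewrite divr_ge0 ?flat_ge0// ltW// step_den_gt0. Qed.

Lemma step_le1 x : step x <= 1.
Proof. by rewrite ler_pdivrMr ?step_den_gt0// mul1r lerDl flat_ge0. Qed.

Lemma step_eq0 x : x <= 0 -> step x = 0.
Proof. by move=> x0; rewrite /step flat_eq0// mul0r. Qed.

Lemma step_eq1 x : 2^-1 <= x -> step x = 1.
Proof.
move=> x0; rewrite /step (@flat_eq0 _ (_ - _)) ?subr_le0// addr0 divff//.
by have := step_den_gt0 x; rewrite (@flat_eq0 _ (_ - _)) ?subr_le0// addr0 => /gt_eqF ->.
Qed.

Lemma is_derive_step x : is_derive x 1 step (derive1 step x).
Proof. exact: diffn_deriv (diffn_step 1) x. Qed.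

Lemma continuous_dstep : continuous (derive1 step).
Proof.
move=> x; apply: differentiable_continuous; apply/derivable1_diffP.
exact: (diffn_step 2).2.1.
Qed.

Lemma dstep_eq0 x : 1 <= `|x| -> derive1 step x = 0.
Proof.
move=> x1; rewrite derive1E.
(* Such an [x] lies strictly outside [0, 1/2], so [step] is constant, 0 or 1, in a neighbourhood of
   it. *)
suff : exists c, \forall y \near x, cst c y = step y.
  by move=> [c /near_eq_derive]<-; rewrite derive_cst.
have [x0|x0] := leP 0 x; [exists 1|exists 0]; near=> y => /=.
- rewrite step_eq1//; apply: ltW; near: y; apply: lt_nbhsr.
  by rewrite ger0_norm in x1 => //; lra.
- by rewrite step_eq0//; apply: ltW; near: y; exact: lt_nbhsl.
Unshelve. all: by end_near. Qed.

(** The derivative is continuous, so its absolute value attains a maximum on [-1, 1]; outside it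
    vanishes. *)
Lemma dstep_bounded : exists M, forall x, `|derive1 step x| <= M.
Proof.
have [y y1 yM] : exists2 y, y \in `[-1, 1]%R & forall x,
    x \in `[-1, 1]%R -> `|derive1 step x| <= `|derive1 step y|.
  apply: EVT_max; first by lra.
  apply: continuous_subspaceT => x; apply: continuous_comp; first exact: continuous_dstep.
  exact: norm_continuous.
exists `|derive1 step y| => x; have [x1|x1] := leP `|x| 1.
  by apply: yM; rewrite in_itv/= -ler_norml.
by rewrite dstep_eq0 ?normr0// ltW.
Qed.

End diffn.

Lemma integrable_cst_lty {R : realType} d (T : measurableType d)
  (mu : {measure set T -> \bar R}) (A : set T) (k : R) :
  measurable A -> (mu A < +oo)%E -> mu.-integrable A (EFin \o (fun=> k)).
Proof.
move=> mA Aoo; apply/integrableP; split; first exact: measurable_cst.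
have /= -> := @integral_cst _ _ _ mu A mA `|k%:E|%E.
by rewrite lte_mul_pinfty.
Qed.

(** * Rescaled steps, and their derivatives as approximate identities *)

Section ramp.
Context {R : realType}.
Local Notation leb1 := (@lebesgue_measure R).
Implicit Types (a b c d r x : R) (f : R -> R).

Definition ramp c r x : R := step (r^-1 * (x - c)).
(** The derivative of [ramp c r]. For [r > 0] it vanishes off [ball c r], has integral 1 and is of
    size at most [M / r]: an approximate identity at [c]. *)
Definition dramp c r x : R := r^-1 * derive1 step (r^-1 * (x - c)).

Lemma ramp_ge0 c r x : 0 <= ramp c r x. Proof. exact: step_ge0. Qed.

Lemma ramp_le1 c r x : ramp c r x <= 1. Proof. exact: step_le1. Qed.

Lemma ramp_eq0 c r x : 0 < r -> x <= c -> ramp c r x = 0.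
Proof.
by move=> r0 xc; rewrite /ramp step_eq0// pmulr_rle0 ?invr_gt0// subr_le0.
Qed.

Lemma ramp_eq1 c r x : 0 < r -> c + r <= x -> ramp c r x = 1.
Proof.
move=> r0 xc; rewrite /ramp step_eq1//.
rewrite mulrC ler_pdivlMr//; lra.
Qed.

Lemma rampE c r : ramp c r = (fun x => step (r^-1 * x + - (r^-1 * c))).
Proof. by apply/funext => x; rewrite /ramp mulrBr. Qed.

Lemma diffn_ramp c r n : diffn n (ramp c r).
Proof. by rewrite rampE; apply: diffn_affine; exact: diffn_step. Qed.

Lemma is_derive_ramp c r x : is_derive x 1 (ramp c r) (dramp c r x).
Proof.
have da : is_derive x 1 (fun x => r^-1 * (x - c)) r^-1.
  by apply: is_derive_eq; rewrite /GRing.scale/=; ring.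
apply: (is_derive_eq (@is_derive1_comp _ step _ x _ _ (is_derive_step _) da)).
by rewrite mulrC.
Qed.

Lemma derive1_ramp c r : derive1 (ramp c r) = dramp c r.
Proof.
by apply/funext => x; have d := is_derive_ramp c r x; rewrite derive1E derive_val.
Qed.

Lemma continuous_ramp c r : continuous (ramp c r).
Proof.
move=> x; apply: differentiable_continuous; apply/derivable1_diffP.
exact: (diffn_ramp c r 1).1.
Qed.

Lemma continuous_dramp c r : continuous (dramp c r).
Proof.
rewrite -derive1_ramp => x.
apply: differentiable_continuous; apply/derivable1_diffP.
exact: (diffn_ramp c r 2).2.1.
Qed.

Lemma measurable_ramp c r : measurable_fun setT (ramp c r).
Proof. exact: continuous_measurable_fun (@continuous_ramp c r). Qed.

Lemma measurable_dramp c r : measurable_fun setT (dramp c r).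
Proof. exact: continuous_measurable_fun (@continuous_dramp c r). Qed.

Lemma dramp_eq0 c r x : 0 < r -> ~ ball c r x -> dramp c r x = 0.
Proof.
move=> r0 xc; have {}xc : r <= `|x - c|.
  by rewrite leNgt distrC; apply/negP => h; apply: xc; rewrite -ball_normE.
rewrite /dramp dstep_eq0 ?mulr0// normrM gtr0_norm ?invr_gt0// mulrC.
by rewrite ler_pdivlMr// mul1r.
Qed.

Lemma dramp_bounded : exists2 M, 0 < M &
  forall c r x, 0 < r -> `|dramp c r x| <= M / r.
Proof.
have [M HM] := @dstep_bounded R; exists (`|M| + 1); first by rewrite ltr_pwDr.
move=> c r x r0; rewrite normrM gtr0_norm ?invr_gt0// mulrC.
rewrite ler_pM2r ?invr_gt0//; apply: le_trans (HM _) _.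
by rewrite (le_trans (ler_norm _))// lerDl.
Qed.

(** An integrable function times a bounded one. The measure is left general because both Lebesgue
    measure and [leb a b] occur below. *)
Lemma integrable_dramp c r (w : R -> R) (A : set R)
  (mu : {measure set (measurableTypeR R) -> \bar R}) :
  0 < r -> measurable A ->
  mu.-integrable A (EFin \o w) -> mu.-integrable A (EFin \o (fun x => w x * dramp c r x)).
Proof.
move=> r0 mA iw; have [M M0 HM] := dramp_bounded.
have -> : EFin \o (fun x => w x * dramp c r x) = ((EFin \o w) \* (EFin \o dramp c r))%E.
  by [].
apply: (@integrableMl _ _ _ mu A mA (EFin \o w) (dramp c r) iw).
  exact: measurable_funS (@measurable_dramp c r).
exists (M / r); split; first exact: num_real.
by move=> k Mk x _ /=; apply: le_trans (HM _ _ _ r0) (ltW Mk).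
Qed.

Lemma integral_dramp c r : 0 < r -> \int[leb1]_(x in ball c r) dramp c r x = 1.
Proof.
move=> r0.
have <- : \int[leb1]_(x in `[c - r, c + r]) dramp c r x = 1.
  have h : (c - r < c + r)%R by lra.
  rewrite /Rintegral (@continuous_FTC2 R (dramp c r) (ramp c r))//.
  - by rewrite -EFinB/= ramp_eq1 ?ramp_eq0 ?subr0//; lra.
  - exact/continuous_subspaceT/continuous_dramp.
  - split.
    + by move=> x _; exact: (diffn_ramp c r 1).1.
    + exact/cvg_at_right_filter/continuous_ramp.
    + exact/cvg_at_left_filter/continuous_ramp.
  - by move=> x _; rewrite derive1_ramp.
rewrite ball_itv.
have icr : leb1.-integrable `[c - r, c + r] (EFin \o dramp c r).
  apply: continuous_compact_integrable; first exact: segment_compact.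
  exact/continuous_subspaceT/continuous_dramp.
rewrite Rintegral_itv_obnd_cbnd ?Rintegral_itv_bndo_bndc//.
- by apply: integrableS icr => //; apply: subset_itvl; rewrite bnd_simp.
- by apply: integrableS icr => //; exact: subset_itv_oo_cc.
Qed.

(** Since [dramp c r] has mass 1, the error is the integral of [(w x - w c) * dramp c r x] over
    [ball c r]. With [dramp] at most [M / r] and the ball of length [2 r], it is at most [2 M] times
    the average of [|w - w c|], which tends to 0 at a Lebesgue point. *)
Lemma dramp_approx (w : R -> R) c :
  leb1.-integrable setT (EFin \o w) -> lebesgue_pt w c ->
  \int[leb1]_x (w x * dramp c r x) @[r --> 0^'+] --> w c.
Proof.
move=> iw wc; have [M M0 HM] := dramp_bounded.
have bnd r : 0 < r ->
    (`|\int[leb1]_x (w x * dramp c r x) - w c|%:E <= (M * 2)%:E * davg w c r)%E.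
  move=> r0.
  have mB : measurable (ball c r : set (measurableTypeR R)) by exact: measurable_ball.
  have cB : leb1 (ball c r) = (r *+ 2)%:E by rewrite lebesgue_measure_ball// ltW.
  have ooB : (leb1 (ball c r) < +oo)%E by rewrite cB ltry.
  have iB : leb1.-integrable (ball c r) (EFin \o w) by exact: integrableS iw.
  have icst : leb1.-integrable (ball c r) (EFin \o (fun=> w c)).
    by apply: integrable_cst_lty.
  have id : leb1.-integrable (ball c r) (EFin \o (fun x => w x - w c)).
    by have := integrableB mB iB icst.
  have -> : \int[leb1]_x (w x * dramp c r x) =
            \int[leb1]_(x in ball c r) (w x * dramp c r x).
    rewrite [RHS]Rintegral_mkcond; apply: eq_Rintegral => x _.
    rewrite patchE; case: ifPn => //; rewrite notin_setE => xB.
    by rewrite dramp_eq0 ?mulr0.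
  have -> : \int[leb1]_(x in ball c r) (w x * dramp c r x) - w c =
            \int[leb1]_(x in ball c r) ((w x - w c) * dramp c r x).
    (* The constant [w c] is written as the integral of [w c * dramp c r], so that the two terms
       merge into one integral. *)
    rewrite -[X in _ - X]mulr1 -(integral_dramp c r0) -RintegralZl//; last first.
      have -> : dramp c r = fun x => cst 1 x * dramp c r x.
        by apply/funext => x; rewrite mul1r.
      apply: integrable_dramp => //.
      by apply: integrable_cst_lty.
    rewrite -RintegralB//; [|exact: integrable_dramp..].
    by apply: eq_Rintegral => x _; rewrite mulrBl.
  rewrite EFin_normr_Rintegral//; last exact: integrable_dramp.
  apply: (@le_trans _ _ (\int[leb1]_(x in ball c r) ((M / r)%:E * `|(w x - w c)%:E|))%E).
    apply: le_trans (le_abse_integral _ _ _) _ => //.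
      by have /integrableP[] := integrable_dramp c r0 mB id.
    apply: ge0_le_integral => //.
    - apply/measurable_EFinP/measurableT_comp => //.
      by have /integrableP[/measurable_EFinP ? _] := integrable_dramp c r0 mB id.
    - apply: emeasurable_funM => //.
      by apply/measurableT_comp => //; have /integrableP[] := id.
    - move=> x _; rewrite abse_EFin -EFinM lee_fin normrM mulrC.
      by rewrite ler_wpM2r// HM.
  rewrite ge0_integralZl//; last 2 first.
  - by apply/measurableT_comp => //; have /integrableP[] := id.
  - by rewrite lee_fin divr_ge0// ltW.
  rewrite /davg /iavg cB inver mulrn_eq0/= gt_eqF// muleA -EFinM.
  rewrite (_ : M * 2 * (r *+ 2)^-1 = M / r)//.
  by field; rewrite gt_eqF.
apply/cvgrPdist_le => e e0.
have M20 : 0 < M * 2 by rewrite mulr_gt0.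
have wce : \forall r \near 0^'+, (davg w c r < (e / (M * 2))%:E)%E.
  apply: (wc (fun y => (y < (e / (M * 2))%:E)%E)).
  by apply: open_ereal_lt'; rewrite lte_fin divr_gt0.
near=> r; have r0 : 0 < r by [].
rewrite distrC -lee_fin (le_trans (bnd r r0))//.
rewrite [leRHS](_ : _ = (M * 2)%:E * (e / (M * 2))%:E)%E; last first.
  by rewrite -EFinM mulrC mulfVK ?gt_eqF.
rewrite lee_pmul2l ?lte_fin//.
by apply: ltW; near: r.
Unshelve. all: by end_near. Qed.

(** Left of [c] both ramps are 0 and right of [d + r] both are 1, even when their rises overlap; so
    the support lies in the closed interval [c, d + r], inside ]a, b[. *)
Lemma test_function_ramp a b c d r : a < c -> c < d -> 0 < r -> d + r < b ->
  test_function a b (fun x => ramp c r x - ramp d r x).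
Proof.
move=> ac cd r0 db; split.
  apply/diffnP => n.
  have := diffnD (diffn_ramp c r n) (diffnM (diffn_cst n (-1)) (diffn_ramp d r n)).
  by congr diffn; apply/funext => x; rewrite mulN1r.
apply: (@subset_trans _ `[c, d + r]%classic); last first.
  move=> x /=; rewrite !in_itv/= => /andP[cx xd].
  by rewrite (lt_le_trans ac cx) (le_lt_trans xd db).
rewrite [X in _ `<=` X](_ : _ = closure `[c, d + r]%classic); last first.
  by apply/closure_id; exact: itv_closed.
apply: closure_subset => x /=; rewrite in_itv/=; apply: contraNP => /negP.
rewrite negb_and -!ltNge => /orP[xc|dx].
  by rewrite !ramp_eq0 ?subr0// ltW// (lt_trans xc).
by rewrite !ramp_eq1 ?subrr// ltW// (le_lt_trans _ dx)// lerD2r ltW.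
Qed.

(** At each point the sequence is eventually constant. A ramp starting at [e] is 0 at [e] itself and
    eventually 1 at every point beyond, which is why the limit interval is open at [c] and closed at
    [d]. *)
Lemma cvg_ramp c d (r : R^nat) x : (forall n, 0 < r n) -> r n @[n --> \oo] --> (0 : R) ->
  c < d ->
  (ramp c (r n) x - ramp d (r n) x) @[n --> \oo] --> (\1_(`]c, d]%classic : set R) x : R).
Proof.
move=> r0 rc cd.
have near1 e : e < x -> \forall n \near \oo, ramp e (r n) x = 1.
  move=> ex; near=> n; rewrite ramp_eq1// -lerBrDl ltW//; near: n.
  by apply: (cvgr_lt _ rc); rewrite subr_gt0.
apply: cvg_near_cst; rewrite indicE mem_setE in_itv/=.
have [xc|cx] := leP x c.
  by apply: nearW => n; rewrite !ramp_eq0 ?subr0// (le_trans xc)// ltW.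
have [xd|dx] := leP x d; near=> n.
- by rewrite (near (near1 _ cx) n)// (ramp_eq0 (r0 n) xd) subr0.
- by rewrite (near (near1 _ cx) n)// (near (near1 _ dx) n)// subrr.
Unshelve. all: by end_near. Qed.

End ramp.

(** * Recovering a function from its weak derivative and its mean *)

Section weak_derivative.
Context {R : realType} (a b : R).
Local Notation leb1 := (@lebesgue_measure R).
Local Notation mu := (leb a b).
Implicit Types (c d x : R) (f : R -> R) (u v w : L2 a b).

Lemma leb_setC : mu (~` `[a, b]) = 0.
Proof. by rewrite /leb/= /mfrestr/= /mrestr setICl measure0. Qed.

Lemma integral_leb_itv (g : R -> \bar R) :
  (\int[mu]_(x in `[a, b]) g x = \int[leb1]_(x in `[a, b]) g x)%E.
Proof.
apply: eq_measure_integral => A mA Aab.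
by rewrite /leb/= /mfrestr/= /mrestr setIidl.
Qed.

Lemma integrable_leb f : mu.-integrable setT (EFin \o f) ->
  leb1.-integrable `[a, b] (EFin \o f).
Proof.
move=> intf.
have /integrableP[mf foo] : mu.-integrable `[a, b] (EFin \o f).
  exact: integrableS intf.
by apply/integrableP; split => //; rewrite -integral_leb_itv.
Qed.

(** Extension by zero passes from [mu] to Lebesgue measure on the line, the setting of Lebesgue
    points and of [dramp_approx]. *)
Lemma integrable_leb_patch f : mu.-integrable setT (EFin \o f) ->
  leb1.-integrable setT (EFin \o (f \_ `[a, b])).
Proof.
move=> /integrable_leb/(integrable_mkcond _ (measurable_ccitv a b)).
by rewrite restrict_EFin.
Qed.

Lemma Rintegral_leb_itv f : mu.-integrable setT (EFin \o f) ->
  \int[mu]_x f x = \int[mu]_(x in `[a, b]) f x.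
Proof.
move=> intf; rewrite /Rintegral.
rewrite (@negligible_integral _ _ _ mu setT (~` `[a, b]))//.
- by rewrite setDE setCK setTI.
- exact: measurableC.
- exact: leb_setC.
Qed.

Lemma Rintegral_leb f : mu.-integrable setT (EFin \o f) ->
  \int[mu]_x f x = \int[leb1]_x (f \_ `[a, b]) x.
Proof.
move=> intf; rewrite -Rintegral_mkcond Rintegral_leb_itv//.
by rewrite /Rintegral -integral_leb_itv.
Qed.

Lemma ae_leb (P : set R) : (\forall x \ae leb1, P x) ->
  \forall x \ae mu, P x.
Proof.
move=> [N [mN N0 PN]]; exists N; split => //.
apply/eqP; rewrite -measure_le0 -N0 /leb/= /mfrestr/= /mrestr.
by apply: le_measure; rewrite ?inE//; exact: measurableI.
Qed.

(** The complement of [a, b] and the two endpoints are null. Interior points are wanted because the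
    plateaus must be supported in ]a, b[. *)
Lemma ae_leb_itvoo : \forall x \ae mu, x \in `]a, b[%R.
Proof.
have neq e : \forall x \ae mu, x != e.
  apply: ae_leb; exists [set e]; split; [exact: measurable_set1| |].
    exact: lebesgue_measure_set1.
  by move=> x /negP; rewrite negbK => /eqP.
have ab : \forall x \ae mu, x \in `[a, b]%R.
  exists (~` `[a, b]); split; [exact: measurableC|exact: leb_setC|].
  by move=> x.
near=> x.
have xa : x != a by near: x; exact: neq.
have xb : x != b by near: x; exact: neq.
have : x \in `[a, b]%R by near: x; exact: ab.
by rewrite !in_itv/= => /andP[ax bx]; rewrite lt_neqAle eq_sym xa ax lt_neqAle xb.
Unshelve. all: by end_near. Qed.

Lemma weak_derivative_increment w v c d : weak_derivative w v ->
  a < c -> c < d -> d < b ->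
  lebesgue_pt ((w : R -> R) \_ `[a, b]) c ->
  lebesgue_pt ((w : R -> R) \_ `[a, b]) d ->
  w d - w c = \int[mu]_(y in `[a, d]) v y - \int[mu]_(y in `[a, c]) v y.
Proof.
move=> wv ac cd db pc pd.
(* The shifted index makes the factor [1 / (n + 2)], strictly below 1 already at [n = 0], so that
   [d + r n < b] for every [n]. *)
pose r n := (b - d) * harmonic n.+1.
have bd0 : 0 < b - d by rewrite subr_gt0.
have r0 n : 0 < r n by rewrite mulr_gt0// /harmonic/= invr_gt0.
have rb n : d + r n < b.
  by rewrite -ltrBrDl /r gtr_pMr// /harmonic/= invf_lt1// ltr1n.
have rc : r n @[n --> \oo] --> (0 : R).
  rewrite -[X in _ --> X](mulr0 (b - d)); apply: cvgMr.
  by rewrite (@cvg_shiftS R harmonic); exact: cvg_harmonic.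
have iw := L2_integrable w (@measurableT _ (measurableTypeR R)).
have iv := L2_integrable v (@measurableT _ (measurableTypeR R)).
pose W := (w : R -> R) \_ `[a, b].
have iW : leb1.-integrable setT (EFin \o W) by exact: integrable_leb_patch.
have WE x : a < x -> x < b -> W x = w x.
  by move=> ax xb; rewrite /W patchE mem_set//= in_itv/= !ltW.
pose phi n x := ramp c (r n) x - ramp d (r n) x.
have lhs n : \int[mu]_x (w x * derive1 (phi n) x) =
    \int[leb1]_x (W x * dramp c (r n) x) - \int[leb1]_x (W x * dramp d (r n) x).
  have -> : derive1 (phi n) = fun x => dramp c (r n) x - dramp d (r n) x.
    apply/funext => x; rewrite derive1E.
    have h1 := is_derive_ramp c (r n) x; have h2 := is_derive_ramp d (r n) x.
    by have := is_deriveB h1 h2 => h; rewrite [LHS](@derive_val _ _ _ _ _ _ _ h).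
  have i1 := integrable_dramp c (r0 n) measurableT iw.
  have i2 := integrable_dramp d (r0 n) measurableT iw.
  rewrite (@eq_Rintegral _ _ _ mu setT
    (fun x => w x * dramp c (r n) x - w x * dramp d (r n) x)); last first.
    by move=> x _; rewrite mulrBr.
  rewrite [LHS](RintegralB measurableT i1 i2) (Rintegral_leb i1) (Rintegral_leb i2).
  by congr (_ - _); apply: eq_Rintegral => x _; rewrite /W !patchE;
    case: ifP; rewrite ?mul0r.
have cvgW e : a < e -> e < b -> lebesgue_pt W e ->
    \int[leb1]_x (W x * dramp e (r n) x) @[n --> \oo] --> w e.
  move=> ae eb pe; rewrite -(WE _ ae eb).
  have /cvg_at_rightP := dramp_approx iW pe; apply; split => // n; exact: r0.
have lim1 : \int[mu]_x (w x * derive1 (phi n) x) @[n --> \oo] --> w c - w d.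
  under eq_fun do rewrite lhs.
  by apply: cvgB; apply: cvgW => //; [exact: lt_trans db|exact: lt_trans cd].
(* Dominated convergence: each plateau is a difference of two values in [0, 1], so [|v|]
   dominates. *)
have lim2 : \int[mu]_x (v x * phi n x) @[n --> \oo] --> \int[mu]_(x in `]c, d]) v x.
  have mphi n : measurable_fun setT (phi n).
    by apply: measurable_funB; exact: measurable_ramp.
  have mv : measurable_fun setT (v : R -> R).
    by move/integrableP: iv => [/measurable_EFinP].
  rewrite Rintegral_mkcond; apply: fine_cvg; rewrite fineK; last first.
    apply: integrable_fin_num => //.
    have mcd : measurable (`]c, d]%classic : set (measurableTypeR R)) by [].
    have /(integrable_mkcond _ mcd) := integrableS measurableT mcd (@subsetT _ _) iv.
    by rewrite restrict_EFin.
  apply: (@dominated_cvg _ _ _ mu setT _ (fun n x => (v x * phi n x)%:E)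
    _ (fun x => `|(v x)%:E|%E)) => //.
  - by move=> n; apply/measurable_EFinP; exact: (measurable_funM mv (mphi n)).
  - move=> x _; apply: cvg_EFin; first exact: nearW.
    rewrite (_ : (_ \_ _) x = v x * \1_(`]c, d]%classic : set R) x); last first.
      by rewrite patchE indicE; case: ifP; rewrite ?mulr1 ?mulr0.
    by apply: cvgM; [exact: cvg_cst|exact: cvg_ramp].
  - exact: integrable_abse.
  - move=> n x _; rewrite -[leRHS]mule1 EFinM abseM lee_wpmul2l// lee_fin.
    have := ramp_ge0 c (r n) x; have := ramp_le1 c (r n) x.
    have := ramp_ge0 d (r n) x; have := ramp_le1 d (r n) x.
    by rewrite ler_norml /phi => *; apply/andP; split; lra.
(* The weak derivative identity turns the sequence of [lim1] into the opposite of that of [lim2];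
   uniqueness of the limit then equates the two values. *)
have lim3 : \int[mu]_x (w x * derive1 (phi n) x) @[n --> \oo] -->
    - \int[mu]_(x in `]c, d]) v x.
  under eq_fun => n do rewrite (wv _ (test_function_ramp ac cd (r0 n) (rb n))).
  exact: cvgN.
have E : w c - w d = - \int[mu]_(x in `]c, d]) v x.
  by apply: (cvg_unique _ lim1 lim3).
rewrite -(opprB (w c)) E opprK.
rewrite (@itv_bndbnd_setU _ _ (BLeft a) (BRight c) (BRight d)) ?bnd_simp ?ltW//.
rewrite Rintegral_setU//=.
- by rewrite addrC addKr.
- by apply: (integrableS measurableT) iv => //; exact: measurableU.
- apply/disj_setPS => y [/=]; rewrite 2!in_itv/= => /andP[_ yx] /andP[].
  by rewrite ltNge yx.
Qed.

Lemma weak_derivative_primitive w v : a < b -> weak_derivative w v -> L20 w ->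
  w = primitive v.
Proof.
move=> ab wv w0.
have muT : mu setT = (b - a)%:E.
  by rewrite /leb/= /mfrestr/= /mrestr setTI lebesgue_measure_itv/= lte_fin ab EFinB.
pose V x := \int[mu]_(y in `[a, x]) v y.
pose W := (w : R -> R) \_ `[a, b].
have iw := L2_integrable w (@measurableT _ (measurableTypeR R)).
have iW : leb1.-integrable setT (EFin \o W) by exact: integrable_leb_patch.
have pts : \forall x \ae mu, x \in `]a, b[%R /\ lebesgue_pt W x.
  apply: filterI; first exact: ae_leb_itvoo.
  by apply/ae_leb/lebesgue_differentiation/open_integrable_locally => //; exact: openT.
(* One interior Lebesgue point [e] serves as base point, with [K = w e - V e]. It exists because
   [mu] has positive mass [b - a], so the almost-everywhere filter is proper. *)
have [K wK] : exists K, forall x, x \in `]a, b[%R /\ lebesgue_pt W x -> w x = V x + K.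
  have PF : ProperFilter (nbhs (almost_everywhere mu)).
    have muT0 : (0 < mu setT)%E by rewrite muT lte_fin subr_gt0.
    exact: (ae_properfilter_algebraOfSetsType muT0).
  have [e [+ pe]] := filter_ex pts; rewrite in_itv/= => /andP[ae eb].
  exists (w e - V e) => x [+ px]; rewrite in_itv/= => /andP[ax xb].
  have [xe|ex|->] := ltgtP x e; last by rewrite addrC subrK.
  - have := weak_derivative_increment wv ax xe eb px pe; rewrite -/(V x) -/(V e); lra.
  - have := weak_derivative_increment wv ae ex xb pe px; rewrite -/(V x) -/(V e); lra.
have wE : (w : R -> R) = (fun x => V x + K) %[ae mu].
  by apply: filterS pts => x /wK + _.
pose m := \int[mu]_(y in `[a, b]) V y.
have KE : K = - ((b - a)^-1 * m).
  have iP : mu.-integrable setT (EFin \o primitive_fun v).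
    apply/Lfun1_integrable; apply: Lfun_subset12; last exact: primitive_Lfun.
    by rewrite fin_num_measure.
  have icst k : mu.-integrable setT (EFin \o (fun=> k)).
    by apply: integrable_cst_lty => //; rewrite -ge0_fin_numE// fin_num_measure.
  pose k := (b - a)^-1 * m.
  (* [V] differs from [primitive_fun v] by the constant [k], and the latter is already known to be
     square integrable. *)
  have iV : mu.-integrable setT (EFin \o V).
    have -> : EFin \o V = ((EFin \o primitive_fun v) \+
        (EFin \o cst k))%E.
      by apply/funext => x /=; rewrite /primitive_fun -EFinD subrK.
    by have := integrableD measurableT iP (icst k).
  (* Integrating [w = V + K] over [a, b]; the zero mean of [w] then forces the value of [K]. *)
  have : \int[mu]_x w x = m + K * (b - a).
    have <- : \int[mu]_x K = K * (b - a).
      by rewrite Rintegral_cst//; congr (K * _); exact: (congr1 fine muT).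
    rewrite -[m](Rintegral_leb_itv iV) -[RHS](RintegralD measurableT iV (icst K)).
    congr fine; apply: ae_eq_integral => //.
    - by move/integrableP: iw => [].
    - by move/integrableP: (integrableD measurableT iV (icst K)) => [].
    - by apply: filterS wE => x h _; rewrite h.
  rewrite w0 => /eqP; rewrite eq_sym addr_eq0 => /eqP mE.
  by rewrite mE mulrN opprK mulrCA mulVf ?mulr1// subr_eq0 gt_eqF.
apply: L2_eq; apply: filterS2 wE (L2_classE (primitive_Lfun v)) => x /(_ Logic.I) -> h _.
by rewrite h// KE.
Qed.

End weak_derivative.

Theorem mainTheorem11 (R : realType) (a b : R) (hab : (a < b)%R)
  (z : L2 a b * L2 a b * L2 a b * L2 a b) (hz : domI z) :
  opF (PiE (opG z)) = PiI z.
Proof.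
move: z hz => [[[w pw] phi] pphi] [[v wv] w0 _].
(* Membership of [w] in [H1] ensures that [Dx w] is a genuine weak derivative and not the default
   value 0. *)
have Dw : weak_derivative w (Dx w) by exact: (xgetPex 0 (ex_intro _ v wv)).
(* [PiE] annihilates the fifth component, so the third component of the image is [Dx w - 0]; the
   first is [primitive (Dx w)], which is [w]. *)
by rewrite /opF /PiE /opG /PiI subr0 -(weak_derivative_primitive hab Dw w0).
Qed.
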